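(* Let $k$ be a commutative ring, $(\mathcal{O},\mu)$ an operad with multiplication in $k$-modules and $\mathcal{M}$ a cyclic unital comp module over $\mathcal{O}$. Then the Lie derivative $\mathcal{L}$ defines a dg Lie algebra representation of $(\mathcal{O}^{\bullet+1},\{\cdot,\cdot\})$ on $\mathcal{M}_{-\bullet}$. Explicitly, for any two $\varphi\in\mathcal{O}(p)$ and $\psi\in\mathcal{O}(q)$, $$[\mathcal{L}_\varphi,\mathcal{L}_\psi]=\mathcal{L}_{\{\varphi,\psi\}};$$ furthermore, the simplicial differential $b$ of $\mathcal{M}_\bullet$ satisfies $$b=-\mathcal{L}_\mu,$$ and therefore $$[b,\mathcal{L}_\varphi]+\mathcal{L}_{\delta\varphi}=0.$$ Here $[\mathcal{L}_\varphi,\mathcal{L}_\psi]=\mathcal{L}_\varphi\mathcal{L}_\psi-(-1)^{(p-1)(q-1)}\mathcal{L}_\psi\mathcal{L}_\varphi$ and $[b,\mathcal{L}_\varphi]=b\mathcal{L}_\varphi-(-1)^{p-1}\mathcal{L}_\varphi b$ are graded commutators.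
   Context: Unadorned tensor products are over $k$. Operad with multiplication. An operad (non-$\Sigma$, in $k$-modules) is a sequence $\{\mathcal{O}(n)\}_{n\ge0}$ of $k$-modules with $k$-bilinear operations $\circ_i:\mathcal{O}(p)\otimes\mathcal{O}(q)\to\mathcal{O}(p+q-1)$ and an identity $\mathbb{1}\in\mathcal{O}(1)$ such that for $\varphi\in\mathcal{O}(p)$, $\psi\in\mathcal{O}(q)$, $\chi\in\mathcal{O}(r)$: $\varphi\circ_i\psi=0$ if $p<i$ or $p=0$; $$(\varphi\circ_i\psi)\circ_j\chi=\begin{cases}(\varphi\circ_j\chi)\circ_{i+r-1}\psi & j<i,\\ \varphi\circ_i(\psi\circ_{j-i+1}\chi) & i\le j<q+i,\\ (\varphi\circ_{j-q+1}\chi)\circ_i\psi & j\ge q+i;\end{cases}$$ and $\varphi\circ_i\mathbb{1}=\mathbb{1}\circ_1\varphi=\varphi$ for $i\le p$. It is an operad with multiplication if there are $\mu\in\mathcal{O}(2)$ and $e\in\mathcal{O}(0)$ (the unit) with $\mu\circ_1\mu=\mu\circ_2\mu$ and $\mu\circ_1e=\mu\circ_2e=\mathbb{1}$. Cyclic unital comp module over $\mathcal{O}$. This is a sequence $\{\mathcal{M}(n)\}_{n\ge0}$ of $k$-modules with $k$-linear maps $\bullet_i:\mathcal{O}(p)\otimes\mathcal{M}(n)\to\mathcal{M}(n-p+1)$, defined for $1\le i\le n-p+1$ when $0\le p\le n$ (declared zero if $p>n$), and for $i=0$ when $0\le p\le n+1$ (declared zero if $p>n+1$), together with $k$-linear maps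 $t:\mathcal{M}(n)\to\mathcal{M}(n)$ (with $t=\mathrm{id}$ on $\mathcal{M}(0)$), such that for $\varphi\in\mathcal{O}(p)$, $\psi\in\mathcal{O}(q)$, $x\in\mathcal{M}(n)$ and all indices $i,j\geq 0$ for which the operations are defined: if $p>0$, $$\varphi\bullet_i(\psi\bullet_jx)=\begin{cases}\psi\bullet_j(\varphi\bullet_{i+q-1}x)& j<i,\\ (\varphi\circ_{j-i+1}\psi)\bullet_ix& j-p<i\le j,\\ \psi\bullet_{j-p+1}(\varphi\bullet_ix)& 0\le i\le j-p;\end{cases}$$ if $p=0$, $$\varphi\bullet_i(\psi\bullet_jx)=\begin{cases}\psi\bullet_j(\varphi\bullet_{i+q-1}x)& j<i,\\ \psi\bullet_{j+1}(\varphi\bullet_ix)& 0\le i\le j;\end{cases}$$ $\mathbb{1}\bullet_ix=x$ for $i=0,\dots,n$; $\ t(\varphi\bullet_ix)=\varphi\bullet_{i+1}t(x)$ for $i=0,\dots,n-p$; and $t^{n+1}=\mathrm{id}$ on $\mathcal{M}(n)$. Structure on $\mathcal{O}^\bullet$, $\mathcal{O}^n:=\mathcal{O}(n)$. For $\varphi\in\mathcal{O}(p)$, $\psi\in\mathcal{O}(q)$ put $\varphi\,\bar\circ\,\psi:=\sum_{i=1}^p(-1)^{(q-1)(i-1)}\varphi\circ_i\psi$, the Gerstenhaber bracket $\{\varphi,\psi\}:=\varphi\,\bar\circ\,\psi-(-1)^{(p-1)(q-1)}\psi\,\bar\circ\,\varphi\in\mathcal{O}(p+q-1)$, and $\delta\varphi:=\{\mu,\varphi\}\in\mathcal{O}(p+1)$.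 The bracket is a graded Lie bracket when $\mathcal{O}(p)$ is given degree $p-1$. Structure on $\mathcal{M}_\bullet$, $\mathcal{M}_n:=\mathcal{M}(n)$. The boundary $b:\mathcal{M}_n\to\mathcal{M}_{n-1}$ is $b(x)=\sum_{i=0}^{n-1}(-1)^i\mu\bullet_ix+(-1)^n\mu\bullet_0t(x)$ (and $b=0$ on $\mathcal{M}_0$). The Lie derivative $\mathcal{L}_\varphi:\mathcal{M}(n)\to\mathcal{M}(n-p+1)$ along $\varphi\in\mathcal{O}(p)$ is, for $p<n+1$, $$\mathcal{L}_\varphi x:=\sum_{i=1}^{n-p+1}(-1)^{(p-1)(i-1)}\varphi\bullet_ix+\sum_{i=1}^p(-1)^{n(i-1)+p-1}\varphi\bullet_0t^{i-1}(x);$$ for $p=n+1$ it is $\mathcal{L}_\varphi x:=(-1)^{p-1}\varphi\bullet_0N(x)$ with $N=\sum_{i=0}^n(-1)^{in}t^i$; and $\mathcal{L}_\varphi:=0$ for $p>n+1$. (For $p=0$ the second sum is empty.) *)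

(* Defs.v *)
From HB Require Import structures.
From mathcomp Require Import all_boot all_order all_algebra.

Set Implicit Arguments.
Unset Strict Implicit.
Unset Printing Implicit Defensive.

Import GRing.Theory.
Local Open Scope ring_scope.

(* Degrees are natural numbers with truncated subtraction, whereas the modules
   of negative degree, O(-1), M(-1), ..., are zero.  [recast n x] reads [x] in
   degree [n]: it is the transport along [m = n], and 0 if the degrees differ.
   The degrees on the two sides of the formulas below agree whenever no
   subtraction is truncated.  Where one is truncated, the element to be recast
   stands for an element of a module of negative degree, or is the image of
   such an element, and is itself 0. *)
Definition recast (k : comPzRingType) (V : nat -> lmodType k) (m n : nat)
    (x : V m) : V n :=
  match @eqP _ m n with
  | ReflectT e => ecast i (V i) e x
  | ReflectF _ => 0
  end.

Arguments recast {k V m} n x.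

(* (-1)^z; a parity only, so that no inverse is needed in k. *)
Definition sgn (k : comPzRingType) (z : int) : k := (-1) ^+ `|z|%N.

(* [circ i phi psi] is the partial composition at the index i >= 1; the value
   at i = 0 plays no role.  For p = q = 0 the target is O(-1). *)
Record operad (k : comPzRingType) := Operad {
  op_mod :> nat -> lmodType k;
  circ : forall p q : nat, nat -> op_mod p -> op_mod q -> op_mod (p + q).-1;
  op_id : op_mod 1%N;
  circ_linearl : forall p q i (psi : op_mod q),
    linear (fun phi : op_mod p => circ i phi psi);
  circ_linearr : forall p q i (phi : op_mod p),
    linear (fun psi : op_mod q => circ i phi psi);
  circ_out : forall p q i (phi : op_mod p) (psi : op_mod q),
    (p < i)%N || (p == 0%N) -> circ i phi psi = 0;
  circ_circ_lt : forall p q r i j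
      (phi : op_mod p) (psi : op_mod q) (chi : op_mod r),
    (1 <= j)%N -> (j < i)%N ->
    circ j (circ i phi psi) chi
      = recast _ (circ (i + r - 1)%N (circ j phi chi) psi);
  circ_circ_mid : forall p q r i j
      (phi : op_mod p) (psi : op_mod q) (chi : op_mod r),
    (1 <= i)%N -> (i <= j)%N -> (j < q + i)%N ->
    circ j (circ i phi psi) chi
      = recast _ (circ i phi (circ (j - i + 1)%N psi chi));
  circ_circ_ge : forall p q r i j
      (phi : op_mod p) (psi : op_mod q) (chi : op_mod r),
    (1 <= i)%N -> (q + i <= j)%N ->
    circ j (circ i phi psi) chi
      = recast _ (circ i (circ (j - q + 1)%N phi chi) psi);
  circ_idr : forall p i (phi : op_mod p), (1 <= i)%N -> (i <= p)%N ->
    recast p (circ i phi op_id) = phi;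
  circ_idl : forall p (phi : op_mod p), recast p (circ 1%N op_id phi) = phi
}.

Arguments op_id {k o}.
Arguments circ {k o p q} i phi psi.

Record operad_mult (k : comPzRingType) := OperadMult {
  om_operad :> operad k;
  mu : om_operad 2%N;
  mu_unit : om_operad 0%N;
  mu_assoc : circ 1%N mu mu = circ 2%N mu mu;
  mu_unitl : circ 1%N mu mu_unit = op_id;
  mu_unitr : circ 2%N mu mu_unit = op_id
}.

Arguments mu {k o}.
Arguments mu_unit {k o}.

(* The range of indices i for which phi •_i x is defined, for phi in O(p) and
   x in M(n). *)
Definition act_defined (p n i : nat) : bool :=
  if i == 0%N then (p <= n + 1)%N else (p <= n)%N && (i <= n - p + 1)%N.

(* [act i phi x] is phi •_i x; besides the values declared to be zero, its
   values outside [act_defined] play no role. *)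
Record cyclic_comp_module (k : comPzRingType) (O : operad k) :=
    CyclicCompModule {
  cm_mod :> nat -> lmodType k;
  act : forall p n : nat, nat -> O p -> cm_mod n -> cm_mod (n.+1 - p)%N;
  cyc : forall n : nat, {linear cm_mod n -> cm_mod n};
  act_linearl : forall p n i (x : cm_mod n),
    linear (fun phi : O p => act i phi x);
  act_linearr : forall p n i (phi : O p),
    linear (fun x : cm_mod n => act i phi x);
  act_out : forall p n i (phi : O p) (x : cm_mod n),
    (1 <= i)%N -> (n < p)%N -> act i phi x = 0;
  act0_out : forall p n (phi : O p) (x : cm_mod n),
    (n + 1 < p)%N -> act 0%N phi x = 0;
  act_act_lt : forall p q n i j (phi : O p) (psi : O q) (x : cm_mod n),
    (0 < p)%N -> act_defined q n j -> act_defined p (n.+1 - q) i ->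
    (j < i)%N ->
    act i phi (act j psi x)
      = recast _ (act j psi (act (i + q - 1)%N phi x));
  act_act_mid : forall p q n i j (phi : O p) (psi : O q) (x : cm_mod n),
    (0 < p)%N -> act_defined q n j -> act_defined p (n.+1 - q) i ->
    (j < i + p)%N -> (i <= j)%N ->
    act i phi (act j psi x)
      = recast _ (act i (circ (j - i + 1)%N phi psi) x);
  act_act_ge : forall p q n i j (phi : O p) (psi : O q) (x : cm_mod n),
    (0 < p)%N -> act_defined q n j -> act_defined p (n.+1 - q) i ->
    (i + p <= j)%N ->
    act i phi (act j psi x)
      = recast _ (act (j - p + 1)%N psi (act i phi x));
  act0_act_lt : forall q n i j (phi : O 0%N) (psi : O q) (x : cm_mod n),
    act_defined q n j -> act_defined 0%N (n.+1 - q) i ->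
    (j < i)%N ->
    act i phi (act j psi x)
      = recast _ (act j psi (act (i + q - 1)%N phi x));
  act0_act_ge : forall q n i j (phi : O 0%N) (psi : O q) (x : cm_mod n),
    act_defined q n j -> act_defined 0%N (n.+1 - q) i ->
    (i <= j)%N ->
    act i phi (act j psi x)
      = recast _ (act (j + 1)%N psi (act i phi x));
  act_id : forall n i (x : cm_mod n), (i <= n)%N ->
    recast n (act i op_id x) = x;
  cyc_act : forall p n i (phi : O p) (x : cm_mod n), (i + p <= n)%N ->
    cyc _ (act i phi x) = act (i + 1)%N phi (cyc n x);
  cyc0 : forall x : cm_mod 0%N, cyc 0%N x = x;
  cyc_order : forall n (x : cm_mod n), iter n.+1 (cyc n) x = x
}.

Arguments act {k O c p n} i phi x.
Arguments cyc {k O c n}.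

Definition brace (k : comPzRingType) (O : operad k) (p q : nat)
    (phi : O p) (psi : O q) : O (p + q).-1 :=
  \sum_(1 <= i < p.+1)
    sgn k ((q%:Z - 1) * (i%:Z - 1)) *: circ i phi psi.

Definition gerst (k : comPzRingType) (O : operad k) (p q : nat)
    (phi : O p) (psi : O q) : O (p + q).-1 :=
  brace phi psi
  - sgn k ((p%:Z - 1) * (q%:Z - 1)) *: recast _ (brace psi phi).

Definition delta (k : comPzRingType) (O : operad_mult k) (p : nat)
    (phi : O p) : O p.+1 :=
  gerst mu phi.

Definition bdry (k : comPzRingType) (O : operad_mult k)
    (M : cyclic_comp_module O) (n : nat) (x : M n) : M n.-1 :=
  if n == 0%N then 0 else
    \sum_(0 <= i < n) sgn k i%:Z *: recast n.-1 (act i mu x)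
    + sgn k n%:Z *: recast n.-1 (act 0%N mu (cyc x)).

Definition cyc_norm (k : comPzRingType) (O : operad k)
    (M : cyclic_comp_module O) (n : nat) (x : M n) : M n :=
  \sum_(0 <= i < n.+1) sgn k (i%:Z * n%:Z) *: iter i cyc x.

(* For p > n + 1 the target is a module of negative degree. *)
Definition lie (k : comPzRingType) (O : operad k)
    (M : cyclic_comp_module O) (p n : nat) (phi : O p) (x : M n) :
    M (n.+1 - p)%N :=
  if (p < n + 1)%N then
    \sum_(1 <= i < (n - p + 1).+1)
      sgn k ((p%:Z - 1) * (i%:Z - 1)) *: act i phi x
    + \sum_(1 <= i < p.+1)
      sgn k (n%:Z * (i%:Z - 1) + p%:Z - 1) *: act 0%N phi (iter (i - 1)%N cyc x)
  else if p == (n + 1)%N then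
    sgn k (p%:Z - 1) *: act 0%N phi (cyc_norm x)
  else 0.

(* Main.v *)
(** Write t for the cyclic operator on M(n) and tau = (-1)^n t, so that
    tau^(n+1) = 1.  With the action rescaled by signs, the Lie derivative of
    phi in O(p) is the unsigned sum of phi over all n+1 cyclic windows of p
    consecutive positions among 0, ..., n: the windows avoiding 0 give
    phi •_i x, and those containing 0 give phi •_0 tau^j x.  In L_phi L_psi x,
    the terms in which the window of phi contains the output of psi are
    exactly the windows of phi ō psi, and hence sum to the Lie derivative along
    phi ō psi; the other terms have disjoint windows and are symmetric in phi
    and psi up to the sign (-1)^((p-1)(q-1)), so they cancel in the graded
    commutator. *)
Require Import Defs.
From HB Require Import structures.
From mathcomp Require Import all_boot all_order all_algebra.
From mathcomp Require Import zify.

Set Implicit Arguments.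
Unset Strict Implicit.
Unset Printing Implicit Defensive.

Import GRing.Theory.
Local Open Scope ring_scope.

(** * Signs and reindexing of finite sums *)

Lemma odd_abszD (a b : int) : odd (absz (a + b)) = odd (absz a) (+) odd (absz b).
Proof. lia. Qed.

Lemma odd_abszM (a b : int) : odd (absz (a * b)) = odd (absz a) && odd (absz b).
Proof. by rewrite abszM oddM. Qed.

Lemma sgn_odd (k : comPzRingType) (z : int) (n : nat) :
  odd (absz z) = odd n -> sgn k z = (-1) ^+ n.
Proof. by move=> zn; rewrite /sgn -signr_odd zn signr_odd. Qed.

Lemma scale_sign_odd (k : comPzRingType) (V : lmodType k) (a b : nat) (x : V) :
  odd a = odd b -> (-1) ^+ a *: x = (-1) ^+ b *: x.
Proof. by move=> ab; rewrite -signr_odd ab signr_odd. Qed.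

Lemma scale_signK (k : pzRingType) (V : lmodType k) (a : nat) (x : V) :
  (-1) ^+ a *: ((-1) ^+ a *: x) = x.
Proof. by rewrite scalerA -expr2 sqrr_sign scale1r. Qed.

Lemma linear_sum_scale (k : pzRingType) (U V : lmodType k) (f : U -> V) (I : Type)
    (r : seq I) (c : I -> k) (F : I -> U) :
  linear f -> f (\sum_(i <- r) c i *: F i) = \sum_(i <- r) c i *: f (F i).
Proof.
move=> lf; elim: r => [|i r IHr]; last by rewrite !big_cons lf IHr.
by rewrite !big_nil -[0 in LHS]addr0 -[X in X + _](scaler0 _ (-1)) lf scaleN1r addNr.
Qed.

Lemma exchange_triangle (V : nmodType) (a p : nat) (F : nat -> nat -> V) :
  \sum_(a <= i < p) \sum_(i.+1 <= l < p) F i l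
  = \sum_(a <= l < p) \sum_(a <= i < l) F i l.
Proof.
elim: p => [|p IHp]; first by rewrite !big_geq.
have [le_ap|lt_pa] := leqP a p; last by rewrite !big_geq.
rewrite big_nat_recr //= (big_geq (leqnn _)) addr0 [RHS]big_nat_recr //= -IHp.
rewrite -big_split /=; apply: eq_big_nat => i /andP[_ lt_ip].
by rewrite big_nat_recr.
Qed.

Lemma big_nat_shift (V : nmodType) (a b c : nat) (F : nat -> V) :
  \sum_(a + c <= l < b + c) F l = \sum_(a <= i < b) F (i + c)%N.
Proof. by rewrite big_addn addnK. Qed.

Lemma big_nat_shift0 (V : nmodType) (a c : nat) (F : nat -> V) :
  \sum_(c <= l < c + a) F l = \sum_(0 <= i < a) F (c + i)%N.
Proof. rewrite addnC -{1}[c]add0n big_nat_shift.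
by apply: eq_bigr => i _; rewrite addnC. Qed.

(* [E s l] stands for phi o_(s+1) psi applied at 0 after tau^l.  In the left-hand
   side, i is the power of tau between phi and psi: rotating by tau^i, a window
   of psi that avoids 0 stays so (first sum) or passes through 0 (second sum);
   the third sum is over the windows of psi that contain 0. *)
Lemma window_count (V : nmodType) (p q : nat) (E : nat -> nat -> V) :
  \sum_(0 <= i < p) (\sum_(i.+1 <= s < p) E s i
      + \sum_(0 <= s < i) E s (i + q).-1 + \sum_(0 <= j < q) E i (i + j)%N)
  = \sum_(0 <= s < p) \sum_(0 <= l < (p + q).-1) E s l.
Proof.
rewrite !big_split /= exchange_triangle.
rewrite -(exchange_triangle _ _ (fun s i => E s (i + q).-1)) -!big_split /=.
apply: eq_big_nat => s /andP[_ sp].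
(* For fixed s, the three sums cover l < s, l >= s + q and s <= l < s + q respectively. *)
rewrite addrAC -addrA [RHS](big_cat_nat (n := s)) //=; try lia.
congr (_ + _).
rewrite [in RHS](big_cat_nat (n := (s + q)%N)) /=; try lia.
congr (_ + _).
  by rewrite [RHS]big_nat_shift0.
have -> : (p + q).-1 = (p.-1 + q)%N by lia.
by rewrite big_nat_shift big_add1.
Qed.

(** * Transport between degrees *)

Section Recast.

Variables (k : comPzRingType) (V : nat -> lmodType k).

Lemma recast_id n (x : V n) : recast n x = x.
Proof. by rewrite /recast; case: eqP => // e; rewrite eq_axiomK. Qed.

Lemma recast_recast l m n (x : V l) : l = m -> recast n (recast m x) = recast n x.
Proof. by case: _ /; rewrite recast_id. Qed.

Lemma recast_linear m n : linear (@recast k V m n).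
Proof.
move=> a x y; rewrite /recast; case: eqP => [e|_]; last by rewrite scaler0 addr0.
by case: n / e.
Qed.

HB.instance Definition _ m n := GRing.isLinear.Build k (V m) (V n) _
  (@recast k V m n) (@recast_linear m n).

End Recast.

(** * The rescaled action and the rotation tau *)

Section SignedAction.

Variables (k : comPzRingType) (O : operad k) (M : cyclic_comp_module O).

HB.instance Definition _ p n i (phi : O p) :=
  GRing.isLinear.Build k (M n) (M (n.+1 - p)%N) _ (act i phi) (act_linearr i phi).

(* The exponent has the parity of (p - 1)(i - 1) + (p - 1): the last summand is
   the global sign of the Lie derivative, the rest makes tau and the action
   commute without sign. *)
Definition sact p n m i (phi : O p) (x : M n) : M m :=
  (-1) ^+ (p.+1 * i.+1)%N *: recast m (act i phi x).

Lemma sact_linearr p n m i (phi : O p) : linear (sact (n := n) m i phi).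
Proof.
by move=> a x y; rewrite /sact !linearP.
Qed.

HB.instance Definition _ p n m i (phi : O p) := GRing.isLinear.Build k (M n) (M m) _
  (sact m i phi) (@sact_linearr p n m i phi).

Lemma sact_linearl p n m i (x : M n) : linear (fun phi : O p => sact m i phi x).
Proof.
by move=> a phi psi; rewrite /sact act_linearl !linearP.
Qed.

Definition tau n (x : M n) : M n := (-1) ^+ n *: cyc x.

Lemma tau_linear n : linear (@tau n).
Proof.
by move=> a x y; rewrite /tau !linearP.
Qed.

HB.instance Definition _ n := GRing.isLinear.Build k (M n) (M n) _
  (@tau n) (@tau_linear n).

Lemma iter_tau n j (x : M n) :
  iter j (@tau n) x = (-1) ^+ (n * j)%N *: iter j cyc x.
Proof.
elim: j => [|j IHj]; first by rewrite muln0 scale1r.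
by rewrite !iterS IHj /tau linearZ scalerA mulnS exprD.
Qed.

Lemma iter_tau_linear n j : linear (iter j (@tau n)).
Proof. by elim: j => [|j IHj] a x y //=; rewrite IHj linearP. Qed.

HB.instance Definition _ n j := GRing.isLinear.Build k (M n) (M n) _
  (iter j (@tau n)) (@iter_tau_linear n j).

(** The accumulated sign is (-1)^(n(n+1)), and n(n+1) is even. *)
Lemma iter_tau_order n (x : M n) : iter n.+1 (@tau n) x = x.
Proof.
rewrite iter_tau cyc_order -[RHS]scale1r -[1](expr0 (-1)).
by apply: scale_sign_odd; rewrite oddM /=; case: odd.
Qed.

(** Raising i by one adds p + 1 to the exponent in [sact]; since m + p = n + 1, this makes up for
    the differing signs of tau on M(m) and M(n). *)
Lemma tau_sact p n m i (phi : O p) (x : M n) : (m + p)%N = n.+1 -> (i < m)%N ->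
  tau (sact m i phi x) = sact m i.+1 phi (tau x).
Proof.
move=> mpn im; have em : m = (n.+1 - p)%N by lia.
subst m; rewrite /sact /tau !linearZ /= !recast_id !scalerA -!exprD.
rewrite cyc_act; last by lia.
rewrite addn1; apply: scale_sign_odd; rewrite !oddD !oddM /=.
lia.
Qed.

Lemma iter_tau_sact p n m i j (phi : O p) (x : M n) :
  (m + p)%N = n.+1 -> (i + j <= m)%N ->
  iter j (@tau m) (sact m i phi x) = sact m (i + j) phi (iter j (@tau n) x).
Proof.
move=> mpn; elim: j => [|j IHj] ijm; first by rewrite addn0.
by rewrite !iterS IHj ?tau_sact ?addnS //; lia.
Qed.

(* Since tau^(m+1) = 1 on M(m), tau moves the last window avoiding 0 to the
   first one containing it. *)
Lemma tau_sact_wrap p n m (phi : O p) (x : M n) : (m + p)%N = n.+1 ->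
  tau (sact m m phi x) = sact m 0 phi (iter p (@tau n) x).
Proof.
move=> mpn; rewrite -[x in LHS]iter_tau_order -mpn iterD.
by rewrite -[X in sact m X]add0n -iter_tau_sact ?add0n // -iterS iter_tau_order.
Qed.

(** The rotation splits into m - j steps up to the last window avoiding 0, one wrapping step that
    becomes tau^p inside, and l further steps; this gives the exponent (m - j) + p + l. *)
Lemma iter_tau_sact_wrap p n m i j l (phi : O p) (x : M n) :
  (m + p)%N = n.+1 -> (j <= m)%N -> (i <= m)%N -> (i + j = m.+1 + l)%N ->
  iter i (@tau m) (sact m j phi x) = sact m l phi (iter (i + p).-1 (@tau n) x).
Proof.
move=> mpn jm im ijl.
have -> : i = (l + (m - j).+1)%N by lia.
rewrite iterD iterS iter_tau_sact ?subnKC // tau_sact_wrap //.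
rewrite iter_tau_sact ?add0n //; last by lia.
by rewrite -!iterD; congr (sact _ _ _ (iter _ _ _)); lia.
Qed.

(** * Two successive actions, by relative position *)

Lemma act_definedE p n i :
  act_defined p n i = (p <= n.+1)%N && ((i == 0%N) || (i + p <= n.+1)%N).
Proof. by rewrite /act_defined; case: eqP; lia. Qed.

(** The index of phi moves by q - 1, and each unit of it contributes p + 1 to the sign exponent. *)
Lemma sact_sact_lt p q n m i j (phi : O p) (psi : O q) (x : M n) :
  (m + p + q)%N = n.+2 -> (j < i)%N -> (i <= m)%N ->
  sact m i phi (sact (n.+1 - q) j psi x)
  = (-1) ^+ (p.+1 * q.+1)%N *:
      sact m j psi (sact (n.+1 - p) (i + q).-1 phi x).
Proof.
move=> mpq ji im; rewrite /sact !recast_id.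
have E : act i phi (act j psi x) =
    recast _ (act j psi (act (i + q - 1)%N phi x)).
  case: (posnP p) phi mpq => [-> | p_gt0] phi mpq.
    by apply: act0_act_lt => //; rewrite act_definedE; lia.
  by apply: act_act_lt => //; rewrite act_definedE; lia.
rewrite !linearZ /= E recast_recast; last by lia.
rewrite !scalerA -!exprD subn1; apply: scale_sign_odd.
rewrite prednK; last by lia.
by rewrite !oddD !oddM /= oddD; do 4 case: (odd _).
Qed.

Lemma sact_sact_gt p q n m i j (phi : O p) (psi : O q) (x : M n) :
  (m + p + q)%N = n.+2 -> (i < j)%N -> (j <= m)%N ->
  sact m i phi (sact (n.+1 - q) (j + p).-1 psi x)
  = (-1) ^+ (p.+1 * q.+1)%N *: sact m j psi (sact (n.+1 - p) i phi x).
Proof.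
move=> mpq ij jm; rewrite [in RHS]sact_sact_lt // 1?addnAC //.
by rewrite [(q.+1 * _)%N]mulnC scale_signK.
Qed.

(** The remaining sign is the one [circ s.+1 phi psi] carries in the brace. *)
Lemma sact_sact_mid p q n m i s (phi : O p) (psi : O q) (x : M n) :
  (m + p + q)%N = n.+2 -> (s < p)%N -> (i <= m)%N ->
  sact m i phi (sact (n.+1 - q) (i + s) psi x)
  = (-1) ^+ (q.+1 * s)%N *: sact m i (circ s.+1 phi psi) x.
Proof.
move=> mpq sp im; rewrite /sact !recast_id !linearZ /=.
rewrite act_act_mid ?act_definedE; try lia.
rewrite recast_recast; last by lia.
have -> : (i + s - i + 1 = s.+1)%N by lia.
rewrite !scalerA -!exprD; apply: scale_sign_odd.
have -> : ((p + q).-1.+1 = p + q)%N by lia.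
by rewrite !oddD !oddM /= !oddD; do 4 case: (odd _).
Qed.

(** * The Lie derivative and its composites as sums over windows *)

Definition lie_sum p n m (phi : O p) (x : M n) : M m :=
  \sum_(1 <= i < m.+1) sact m i phi x
  + \sum_(0 <= j < p) sact m 0 phi (iter j (@tau n) x).

Lemma lie_sumE p n m (phi : O p) (x : M n) : (m + p)%N = n.+1 ->
  recast m (lie phi x) = lie_sum m phi x.
Proof.
move=> mpn; have em : m = (n.+1 - p)%N by lia.
subst m; rewrite recast_id /lie /lie_sum; case: ltnP => [lt_pn | le_np].
  congr (_ + _).
    have -> : (n - p + 1)%N = (n.+1 - p)%N by lia.
    apply: eq_big_nat => i /andP[i_gt0 _]; rewrite /sact recast_id.
    by congr (_ *: _); apply: sgn_odd; rewrite !(odd_abszM, odd_abszD, oddM) /= !addbT.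
  rewrite big_add1; apply: eq_bigr => i _.
  rewrite subn1 /= iter_tau /sact recast_id linearZ /= scalerA -exprD.
  congr (_ *: _); apply: sgn_odd; rewrite !(odd_abszM, odd_abszD) oddD !oddM /=.
  by do 4 case: (odd _).
(* Here every window contains 0: the first sum is empty and the second is the norm, whose signs are
   those of the powers of tau. *)
have ep : p = n.+1 by lia.
subst p; rewrite addn1 eqxx [X in _ = X + _]big_geq ?subnn // add0r.
rewrite /cyc_norm linear_sum scaler_sumr; apply: eq_bigr => i _.
rewrite iter_tau /sact recast_id !linearZ /= !scalerA -!exprD.
apply: scale_sign_odd; rewrite muln1 !oddD odd_abszM odd_abszD oddM /=.
by do 2 case: (odd _).
Qed.

(* The terms of L_phi L_psi x with disjoint windows in which phi acts to the
   right of psi; those with phi to the left are, up to sign, the terms of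
   [crossing psi phi]. *)
Definition crossing p q n m (phi : O p) (psi : O q) (x : M n) : M m :=
  \sum_(1 <= i < m.+1) \sum_(1 <= j < i)
    sact m i phi (sact (n.+1 - q) j psi x)
  + \sum_(1 <= i < m.+1) \sum_(0 <= j < q)
    sact m i phi (sact (n.+1 - q) 0 psi (iter j (@tau n) x)).

(** The output of psi, at j >= 1, lies left of the window of phi, inside it, or right of it: the sum
    is cut at i and i + p. On the right, the two actions are exchanged. *)
Lemma sact_window p q n m i (phi : O p) (psi : O q) (x : M n) :
  (m + p + q)%N = n.+2 -> (1 <= i)%N -> (i <= m)%N ->
  sact m i phi (\sum_(1 <= j < (n.+1 - q).+1) sact (n.+1 - q) j psi x)
  = \sum_(1 <= j < i) sact m i phi (sact (n.+1 - q) j psi x)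
  + \sum_(0 <= s < p)
      (-1) ^+ (q.+1 * s)%N *: sact m i (circ s.+1 phi psi) x
  + (-1) ^+ (p.+1 * q.+1)%N *:
      \sum_(i.+1 <= j < m.+1) sact m j psi (sact (n.+1 - p) i phi x).
Proof.
move=> mpq i_gt0 im; have -> : (n.+1 - q).+1 = (m + p)%N by lia.
have ipm : (i + p <= m + p)%N by rewrite leq_add2r.
rewrite linear_sum (big_cat_nat (n := i)) ?(leq_trans (leq_addr p i)) //=.
rewrite (big_cat_nat (m := i) (n := (i + p)%N)) ?leq_addr //= addrA; congr (_ + _ + _).
  rewrite big_nat_shift0; apply: eq_big_nat => s /andP[_ sp].
  by rewrite sact_sact_mid.
rewrite big_nat_shift scaler_sumr big_add1; apply: eq_big_nat => j /andP[ij jm].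
by rewrite -(@sact_sact_gt _ _ _ _ _ j.+1) // addSn.
Qed.

(** Rotation by tau^i either moves the output of psi up to l > i, inside the window of phi when l <
    p and disjoint from it otherwise, or wraps it around to s < i, which is always inside since i <
    p. *)
Lemma sact0_window p q n m i (phi : O p) (psi : O q) (x : M n) :
  (m + p + q)%N = n.+2 -> (i < p)%N ->
  sact m 0 phi (iter i (@tau _)
    (\sum_(1 <= j < (n.+1 - q).+1) sact (n.+1 - q) j psi x))
  = \sum_(i.+1 <= s < p)
      (-1) ^+ (q.+1 * s)%N *: sact m 0 (circ s.+1 phi psi) (iter i (@tau n) x)
  + \sum_(0 <= s < i) (-1) ^+ (q.+1 * s)%N *:
      sact m 0 (circ s.+1 phi psi) (iter (i + q).-1 (@tau n) x)
  + (-1) ^+ (p.+1 * q.+1)%N *: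
      \sum_(1 <= j < m.+1)
        sact m j psi (sact (n.+1 - p) 0 phi (iter i (@tau n) x)).
Proof.
move=> mpq ip; set m1 := (n.+1 - q)%N.
rewrite !linear_sum (big_cat_nat (n := (m1 - i).+1)) ?ltnS ?leq_subr //=.
rewrite [RHS]addrAC; congr (_ + _).
  have -> : \sum_(1 <= j < (m1 - i).+1)
      sact m 0 phi (iter i (@tau m1) (sact m1 j psi x)) =
    \sum_(i.+1 <= l < m + p) sact m 0 phi (sact m1 l psi (iter i (@tau n) x)).
    rewrite -[i.+1]add1n; have -> : (m + p)%N = ((m1 - i).+1 + i)%N by lia.
    rewrite big_nat_shift; apply: eq_big_nat => j /andP[_ ji].
    have [mq jm] : (m1 + q = n.+1 /\ j + i <= m1)%N by rewrite /m1; lia.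
    by rewrite iter_tau_sact.
  rewrite (big_cat_nat (n := p)) ?leq_addl //=.
  congr (_ + _); first by apply: eq_big_nat => s /andP[_ sp]; rewrite -sact_sact_mid.
  rewrite addnC big_nat_shift0 big_add1; apply: eq_big_nat => j /andP[_ jm].
  by rewrite -(@sact_sact_gt _ _ _ _ _ j.+1) // addSn addnC.
have -> : m1.+1 = ((m1 - i).+1 + i)%N by lia.
rewrite big_nat_shift0.
apply: eq_big_nat => s /andP[_ si].
have [mq jm im ij] : [/\ m1 + q = n.+1, (m1 - i).+1 + s <= m1, i <= m1
  & i + ((m1 - i).+1 + s) = m1.+1 + s]%N by rewrite /m1; split; lia.
by rewrite (iter_tau_sact_wrap psi x mq jm im ij) -sact_sact_mid // (ltn_trans si).
Qed.

(** Here the output of psi is at 0 and is rotated to i < p, so no disjoint windows arise. *)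
Lemma sact0_window0 p q n m i j (phi : O p) (psi : O q) (x : M n) :
  (m + p + q)%N = n.+2 -> (i < p)%N ->
  sact m 0 phi (iter i (@tau _) (sact (n.+1 - q) 0 psi (iter j (@tau n) x)))
  = (-1) ^+ (q.+1 * i)%N *:
      sact m 0 (circ i.+1 phi psi) (iter (i + j) (@tau n) x).
Proof.
move=> mpq ip; have [mq im] : (n.+1 - q + q = n.+1 /\ 0 + i <= n.+1 - q)%N by lia.
by rewrite iter_tau_sact // -iterD -sact_sact_mid.
Qed.

Lemma lie_sum_comp p q n m (phi : O p) (psi : O q) (x : M n) :
  (m + p + q)%N = n.+2 ->
  lie_sum m phi (lie_sum (n.+1 - q) psi x)
  = \sum_(0 <= s < p)
      (-1) ^+ (q.+1 * s)%N *: lie_sum m (circ s.+1 phi psi) x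
  + (crossing m phi psi x + (-1) ^+ (p.+1 * q.+1)%N *: crossing m psi phi x).
Proof.
move=> mpq; pose c s := (-1 : k) ^+ (q.+1 * s)%N.
pose eps := (-1 : k) ^+ (p.+1 * q.+1)%N.
rewrite [lie_sum m phi _]/lie_sum.
(* Windows of phi avoiding 0 give all of [crossing m phi psi x] and, after exchanging the triangular
   sum, the first half of [crossing m psi phi x]. *)
have -> : \sum_(1 <= i < m.+1) sact m i phi (lie_sum (n.+1 - q) psi x)
  = \sum_(0 <= s < p) c s *: \sum_(1 <= i < m.+1) sact m i (circ s.+1 phi psi) x
    + (crossing m phi psi x
       + eps *: \sum_(1 <= j < m.+1) \sum_(1 <= i < j)
           sact m j psi (sact (n.+1 - p) i phi x)).
  rewrite -exchange_triangle /crossing scaler_sumr.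
  under [X in _ = X + _]eq_bigr do rewrite scaler_sumr.
  rewrite exchange_big_nat -!big_split /=.
  apply: eq_big_nat => i /andP[i_gt0 im].
  rewrite /lie_sum linearD /= sact_window // linear_sum /= -!addrA addrCA; congr (_ + _).
  by congr (_ + _); rewrite addrC linear_sum.
(* Windows of phi containing 0 give the second half of [crossing m psi phi x]; the nested terms are
   collected by [window_count]. *)
have -> : \sum_(0 <= i < p) sact m 0 phi (iter i (@tau _) (lie_sum (n.+1 - q) psi x))
  = \sum_(0 <= s < p) c s *:
      \sum_(0 <= l < (p + q).-1) sact m 0 (circ s.+1 phi psi) (iter l (@tau n) x)
    + eps *: \sum_(1 <= j < m.+1) \sum_(0 <= i < p)
        sact m j psi (sact (n.+1 - p) 0 phi (iter i (@tau n) x)).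
  under [X in _ = X + _]eq_bigr do rewrite scaler_sumr.
  rewrite [X in _ = _ + _ *: X]exchange_big_nat -window_count scaler_sumr -big_split /=.
  apply: eq_big_nat => i /andP[_ ip].
  rewrite /lie_sum !linearD /= sact0_window // addrAC.
  congr (_ + _ + _); rewrite !linear_sum; apply: eq_bigr => j _.
  by rewrite /= sact0_window0.
rewrite addrACA -[X in _ + X]addrA -scalerDr -big_split /=; congr (_ + (_ + _)).
by apply: eq_bigr => s _; rewrite -scalerDr /lie_sum.
Qed.

(** * Bilinearity of the Lie derivative *)

Lemma lie_overflow p n (phi : O p) (x : M n) : (n.+1 < p)%N -> lie phi x = 0.
Proof. by move=> np; rewrite /lie addn1 ltnNge ltnW //= gtn_eqF. Qed.

Lemma lie_sum_linearl p n m (x : M n) :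
  linear (fun phi : O p => lie_sum m phi x).
Proof.
move=> a phi psi; rewrite /lie_sum.
under eq_bigr do rewrite sact_linearl.
under [X in _ + X = _]eq_bigr do rewrite sact_linearl.
by rewrite !big_split /= -!scaler_sumr addrACA scalerDr.
Qed.

Lemma lie_sum_linearr p n m (phi : O p) : linear (lie_sum (n := n) m phi).
Proof.
move=> a x y; rewrite /lie_sum.
under eq_bigr do rewrite linearP.
under [X in _ + X = _]eq_bigr do rewrite !linearP.
by rewrite !big_split /= -!scaler_sumr addrACA scalerDr.
Qed.

Lemma lie_linearl p n (x : M n) : linear (fun phi : O p => lie phi x).
Proof.
have [np | pn] := ltnP n.+1 p => a phi psi.
  by rewrite !lie_overflow // scaler0 addr0.
rewrite -[lie (a *: _ + _) _]recast_id -[lie phi x]recast_id -[lie psi x]recast_id.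
by rewrite !lie_sumE ?subnK // lie_sum_linearl.
Qed.

Lemma lie_linearr p n (phi : O p) : linear (fun x : M n => lie phi x).
Proof.
have [np | pn] := ltnP n.+1 p => a x y.
  by rewrite !lie_overflow // scaler0 addr0.
rewrite -[lie _ (a *: _ + _)]recast_id -[lie phi x]recast_id -[lie phi y]recast_id.
by rewrite !lie_sumE ?subnK // lie_sum_linearr.
Qed.

HB.instance Definition _ p n (phi : O p) := GRing.isLinear.Build k (M n)
  (M (n.+1 - p)%N) _ (@lie k O M p n phi) (@lie_linearr p n phi).

Lemma lie_recast p r n m (phi : O p) (x : M n) : p = r ->
  recast m (lie (recast r phi) x) = recast m (lie phi x).
Proof. by case: r /; rewrite recast_id. Qed.

Lemma lie_recastr p l n m (phi : O p) (x : M l) : l = n ->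
  recast m (lie phi (recast n x)) = recast m (lie phi x).
Proof. by case: n /; rewrite recast_id. Qed.

Lemma recast_lie_linearl p n m (x : M n) :
  linear (fun phi : O p => recast m (lie phi x)).
Proof. by move=> a phi psi; rewrite lie_linearl linearP. Qed.

(** * The bracket relation *)

Lemma lie_brace p q n m (phi : O p) (psi : O q) (x : M n) :
  (m + p + q)%N = n.+2 ->
  recast m (lie (brace phi psi) x)
  = \sum_(0 <= s < p) (-1) ^+ (q.+1 * s)%N *: lie_sum m (circ s.+1 phi psi) x.
Proof.
move=> mpq; rewrite (linear_sum_scale _ _ _ (recast_lie_linearl m x)) big_add1.
apply: eq_big_nat => s /andP[_ sp]; rewrite lie_sumE; last by lia.
congr (_ *: _); apply: sgn_odd.
by rewrite odd_abszM !odd_abszD oddM /= !addbT negbK.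
Qed.

Lemma lie_lie p q n m (phi : O p) (psi : O q) (x : M n) :
  (m + p + q)%N = n.+2 ->
  recast m (lie phi (lie psi x))
  = recast m (lie (brace phi psi) x)
    + (crossing m phi psi x + (-1) ^+ (p.+1 * q.+1)%N *: crossing m psi phi x).
Proof.
move=> mpq; rewrite lie_brace //; have [nq | qn] := ltnP n.+1 q.
  have [m0 p0] : m = 0%N /\ p = 0%N by lia.
  (* Here lie psi x belongs to M(-1), which [lie] encodes as 0 in M(0). *)
  subst m p; rewrite [lie psi x]lie_overflow // !linear0 /crossing.
  by rewrite !big_geq // !(addr0, scaler0).
rewrite lie_sumE; last by lia.
by rewrite -[lie psi x]recast_id lie_sumE ?subnK // lie_sum_comp.
Qed.

Lemma lie_gerst p q n m (phi : O p) (psi : O q) (x : M n) :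
  (m + p + q)%N = n.+2 ->
  recast m (lie phi (lie psi x))
  - sgn k ((p%:Z - 1) * (q%:Z - 1)) *: recast m (lie psi (lie phi x))
  = recast m (lie (gerst phi psi) x).
Proof.
move=> mpq; rewrite /gerst [brace phi psi - _]addrC -[in RHS]scaleNr recast_lie_linearl.
rewrite lie_recast; last by rewrite addnC.
rewrite (@sgn_odd _ _ (p.+1 * q.+1)%N); last first.
  by rewrite odd_abszM !odd_abszD oddM /= !addbT.
rewrite !lie_lie //; last by rewrite addnAC.
rewrite [(q.+1 * p.+1)%N]mulnC.
(* With e the sign, the crossing terms are A + e B and B + e A, and (A + e B) - e (B + e A) = 0
   because e^2 = 1. *)
move: (crossing m phi psi x) (crossing m psi phi x) => A B.
rewrite [in LHS]scalerDr [in X in _ - (_ + X)]scalerDr scale_signK scaleNr.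
by rewrite [_ *: B + A]addrC opprD addrACA subrr addr0 addrC.
Qed.

End SignedAction.

(** * The simplicial differential *)

(** For p = 2 the exponent 3(i + 1) in [sact] has parity opposite to i, whence the minus sign. The
    two windows of [mu] containing 0 give the face i = 0 and the last face, which involves t. *)
Lemma bdryE (k : comPzRingType) (O : operad_mult k)
    (M : cyclic_comp_module O) (n : nat) (x : M n) :
  bdry x = - recast n.-1 (lie mu x).
Proof.
case: n x => [|n] x; first by rewrite lie_overflow // linear0 oppr0.
have sactE i (y : M n.+1) : sgn k i%:Z *: recast n (act i mu y) = - sact n i mu y.
  rewrite /sact -[RHS]scaleN1r scalerA -exprS.
  by apply: scale_sign_odd; rewrite oddS oddM /= negbK.
rewrite lie_sumE ?addn2 // /lie_sum /bdry /=.
rewrite big_add1 /= [X in _ = - (_ + X)]big_nat_recl // big_nat1 /=.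
rewrite big_nat_recl // sactE /tau [sact _ _ _ (_ *: _)]linearZ /= opprD opprD -sumrN.
rewrite (eq_bigr _ (fun i _ => sactE i.+1 x)).
rewrite -addrA addrCA; congr (_ + (_ + _)).
by rewrite -scalerN -sactE scale1r.
Qed.

(* The degree m of the target is n - p - q + 2 in the second clause and n - p
   in the last one; when this is negative, the target is zero. *)
Theorem theorem1p3 (k : comPzRingType) (O : operad_mult k)
    (M : cyclic_comp_module O) :
  [/\ (forall (p n : nat) (x : M n), linear (fun phi : O p => lie phi x)) /\
      (forall (p n : nat) (phi : O p), linear (fun x : M n => lie phi x)),
      forall (p q n m : nat) (phi : O p) (psi : O q) (x : M n),
        (m + p + q = n + 2)%N ->
        recast m (lie phi (lie psi x))
        - sgn k ((p%:Z - 1) * (q%:Z - 1)) *: recast m (lie psi (lie phi x))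
        = recast m (lie (gerst phi psi) x),
      forall (n : nat) (x : M n),
        bdry x = - recast n.-1 (lie mu x)
    & forall (p n m : nat) (phi : O p) (x : M n),
        (m + p = n)%N ->
        recast m (bdry (lie phi x))
        - sgn k (p%:Z - 1) *: recast m (lie phi (bdry x))
        + recast m (lie (delta phi) x) = 0].
Proof.
split.
- by split=> [p n x | p n phi]; [apply: lie_linearl | apply: lie_linearr].
- by move=> p q n m phi psi x mpq; apply: lie_gerst; rewrite mpq addn2.
- exact: bdryE.
move=> p n m phi x mpn.
rewrite !bdryE !linearN /= recast_recast; last by lia.
rewrite lie_recastr; last by lia.
(* With b = -L_mu and delta phi = {mu, phi}, the claim is the bracket relation for [mu] and [phi],
   moved to one side. *)
have mpn2 : (m + 2 + p)%N = n.+2 by lia.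
have <- : _ = recast m (lie (delta phi) x) := lie_gerst mu phi x mpn2.
rewrite (_ : 2%:Z - 1 = 1) // mul1r opprK addrACA addNr.
by rewrite subrr addr0.
Qed.
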